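(* The logic $\mathsf{L}$ is sound and (weakly) complete with respect to expertise frames: for every $\phi\in\mathcal{L}$, $\phi$ is a theorem of $\mathsf{L}$ if and only if $\phi$ is valid (true at every state of every expertise model).
   Context: Let $\mathsf{Prop}$ be a countable set of propositional variables. The language $\mathcal{L}$ is given by $\phi ::= p \mid \neg\phi \mid \phi\wedge\phi \mid \mathsf{E}\phi \mid \mathsf{S}\phi \mid \mathsf{A}\phi$; other connectives are abbreviations. An expertise frame is $(X,P)$ with $P\subseteq 2^X$ satisfying (P1) $X\in P$, (P2) $A\in P\Rightarrow X\setminus A\in P$, (P3) closure under arbitrary intersections; an expertise model adds $v:\mathsf{Prop}\to 2^X$. Satisfaction: atoms and Boolean connectives standard; $M,x\vDash\mathsf{E}\phi$ iff $\|\phi\|_M\in P$; $M,x\vDash\mathsf{S}\phi$ iff for all $A\in P$, $\|\phi\|_M\subseteq A$ implies $x\in A$; $M,x\vDash\mathsf{A}\phi$ iff $M,y\vDash\phi$ for all $y\in X$; $\|\phi\|_M=\{x\mid M,x\vDash\phi\}$. The logic $\mathsf{L}$ is the extension of classical propositional calculus (all propositional tautologies over $\mathcal{L}$) with the axioms: $\mathrm{K}_\mathsf{S}$: $\mathsf{S}\phi\wedge\neg\mathsf{S}\psi\rightarrow\mathsf{S}(\phi\wedge\neg\psi)$; $\mathrm{T}_\mathsf{S}$: $\phi\rightarrow\mathsf{S}\phi$; $5_\mathsf{S}$: $\mathsf{S}\neg\mathsf{S}\phi\rightarrow\neg\mathsf{S}\phi$; $\mathrm{K}_\mathsf{A}$: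 $\mathsf{A}(\phi\rightarrow\psi)\rightarrow(\mathsf{A}\phi\rightarrow\mathsf{A}\psi)$; $\mathrm{T}_\mathsf{A}$: $\mathsf{A}\phi\rightarrow\phi$; $5_\mathsf{A}$: $\neg\mathsf{A}\phi\rightarrow\mathsf{A}\neg\mathsf{A}\phi$; ES: $\mathsf{E}\phi\leftrightarrow\mathsf{A}(\mathsf{S}\phi\rightarrow\phi)$; Inc: $\mathsf{A}\phi\rightarrow\neg\mathsf{S}\neg\phi$; and the rules: modus ponens; $\mathrm{Nec}_\mathsf{A}$: from $\phi$ infer $\mathsf{A}\phi$; $\mathrm{R}_\mathsf{S}$: from $\phi\leftrightarrow\psi$ infer $\mathsf{S}\phi\leftrightarrow\mathsf{S}\psi$. *)

(* Defs.v *)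
From mathcomp Require Import all_boot.
From mathcomp Require Import classical_sets.

Set Implicit Arguments.
Unset Strict Implicit.
Unset Printing Implicit Defensive.

Local Open Scope classical_set_scope.

Section Language.
Variable V : Type.

Inductive formula : Type :=
| Var of V
| Neg of formula
| And of formula & formula
| Exp of formula      (* E: the source has expertise on phi *)
| Snd of formula      (* S: phi is sound *)
| All of formula.     (* A: phi holds at every state *)

Definition Imp (phi psi : formula) : formula := Neg (And phi (Neg psi)).
Definition Iff (phi psi : formula) : formula := And (Imp phi psi) (Imp psi phi).

(* Variables and formulas headed by a modality are the atoms of the
   propositional calculus, with truth values given by h. *)
Fixpoint prop_eval (h : formula -> bool) (phi : formula) : bool :=
  match phi with
  | Neg a => ~~ prop_eval h a
  | And a b => prop_eval h a && prop_eval h b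
  | Var _ | Exp _ | Snd _ | All _ => h phi
  end.

Definition tautology (phi : formula) : Prop :=
  forall h : formula -> bool, prop_eval h phi.

Inductive L_theorem : formula -> Prop :=
| L_taut phi : tautology phi -> L_theorem phi
| L_KS phi psi :
    L_theorem (Imp (And (Snd phi) (Neg (Snd psi))) (Snd (And phi (Neg psi))))
| L_TS phi : L_theorem (Imp phi (Snd phi))
| L_5S phi : L_theorem (Imp (Snd (Neg (Snd phi))) (Neg (Snd phi)))
| L_KA phi psi :
    L_theorem (Imp (All (Imp phi psi)) (Imp (All phi) (All psi)))
| L_TA phi : L_theorem (Imp (All phi) phi)
| L_5A phi : L_theorem (Imp (Neg (All phi)) (All (Neg (All phi))))
| L_ES phi : L_theorem (Iff (Exp phi) (All (Imp (Snd phi) phi)))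
| L_Inc phi : L_theorem (Imp (All phi) (Neg (Snd (Neg phi))))
| L_MP phi psi : L_theorem (Imp phi psi) -> L_theorem phi -> L_theorem psi
| L_NecA phi : L_theorem phi -> L_theorem (All phi)
| L_RS phi psi :
    L_theorem (Iff phi psi) -> L_theorem (Iff (Snd phi) (Snd psi)).

End Language.

Record expertise_frame : Type := ExpertiseFrame {
  state :> Type;
  expertise : set (set state);
  expertiseT : expertise setT;
  expertiseC : forall A, expertise A -> expertise (~` A);
  expertise_bigcap : forall F : set (set state),
    F `<=` expertise -> expertise (\bigcap_(A in F) A)
}.

Record expertise_model (V : Type) : Type := ExpertiseModel {
  model_frame :> expertise_frame;
  valuation : V -> set model_frame
}.

Fixpoint sat (V : Type) (M : expertise_model V) (x : M) (phi : formula V)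
    {struct phi} : Prop :=
  match phi with
  | Var p => valuation p x
  | Neg a => ~ sat x a
  | And a b => sat x a /\ sat x b
  | Exp a => expertise [set y : M | sat y a]
  | Snd a => forall A : set M,
      expertise A -> [set y : M | sat y a] `<=` A -> A x
  | All a => forall y : M, sat y a
  end.

Definition valid (V : Type) (phi : formula V) : Prop :=
  forall (M : expertise_model V) (x : M), sat x phi.

(* Main.v *)
(** Read as boxes, [All] and the dual of [Snd] are both S5 modalities, with [Snd]
    going no further than [All] by the axiom Inc. The worlds of the canonical
    model are the maximal consistent sets that agree with a fixed one on all
    formulas [All a], so that [All] becomes the universal modality. Expertise is
    given to the sets that are saturated for the equivalence "same formulas
    [Snd a]"; the least such set containing [U] consists of the worlds
    equivalent to a member of [U], which is the Kripke reading of [Snd], and [U]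
    is itself saturated when it contains that set, which is the axiom ES. *)
Require Import Defs.
From mathcomp Require Import all_boot.
From mathcomp Require Import boolp classical_sets.

Set Implicit Arguments.
Unset Strict Implicit.
Unset Printing Implicit Defensive.

Local Open Scope classical_set_scope.

Ltac tauto_check :=
  let h := fresh "h" in
  apply: L_taut => h; rewrite /Iff /Imp /=;
  repeat match goal with
  | |- context [prop_eval h ?a] => case: (prop_eval h a)
  | |- context [h ?a] => case: (h a)
  end; by [].

(** * Soundness of the axioms and rules in expertise models *)

Section Soundness.
Variable V : Type.

Section Model.
Variable M : expertise_model V.
Implicit Types (a b : formula V) (x : M) (A B U : set M).

Lemma sat_Imp x a b : sat x (Imp a b) <-> (sat x a -> sat x b).
Proof.
split=> /= [nab sa|ab [sa nsb]]; last exact/nsb/ab.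
by apply: contrapT => nsb; apply: nab.
Qed.

Lemma sat_Iff x a b : sat x (Iff a b) <-> (sat x a <-> sat x b).
Proof.
split=> [[/sat_Imp ab /sat_Imp ba]//|[ab ba]].
by split; apply/sat_Imp.
Qed.

(** Tautologies treat modal formulas as atoms, so truth at [x] is itself one of the assignments [h]
    over which [tautology] quantifies. *)
Lemma sat_prop_eval x a : prop_eval (fun b => `[< sat x b >]) a <-> sat x a.
Proof.
elim: a => /= [p|a iha|a iha b ihb|a _|a _|a _]; try by split=> /asboolP.
- by rewrite -iha; split=> /negP.
- by rewrite -iha -ihb; split=> /andP.
Qed.

Lemma expertise0 : expertise (@set0 M).
Proof. by rewrite -setCT; apply: expertiseC; apply: expertiseT. Qed.

Lemma expertiseU A B : expertise A -> expertise B -> expertise (A `|` B).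
Proof.
move=> eA eB.
have -> : A `|` B = ~` (\bigcap_(C in [set ~` A; ~` B]) C).
  by rewrite bigcap_setU !bigcap_set1 setCI !setCK.
apply/expertiseC/expertise_bigcap => _ [|] ->; exact: expertiseC.
Qed.

(** The extension of [Snd a] is the least expertise set including that of [a], as an intersection of
    expertise sets. *)
Lemma expertise_Snd a : expertise [set x : M | sat x (Snd a)].
Proof.
have -> : [set x : M | sat x (Snd a)] =
    \bigcap_(A in [set A | expertise A /\ [set y : M | sat y a] `<=` A]) A.
  by apply/seteqP; split=> x /= sx A => [[]|eA aA]; apply: sx.
by apply: expertise_bigcap => A [].
Qed.

End Model.

Theorem soundness (phi : formula V) : L_theorem phi -> valid phi.
Proof.
elim=> {phi} [a ta|a b|a|a|a b|a|a|a|a|a b _ ihab _ iha|a _ iha|a b _ ihab] M x.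
- exact/sat_prop_eval/ta.
- apply/sat_Imp => -[/= sa nsb] A eA abA; apply: contrapT => nAx.
  (* [A] covers [a] and not [b], [B] covers [b], so their union covers [a] and contains [x], while
     [A] misses [x]. *)
  apply: nsb => B eB bB; suff: (A `|` B) x by case.
  apply: sa (expertiseU eA eB) _ => y /= ya.
  have [yb|nyb] := pselect (sat y b); first by right; apply: bB.
  by left; apply: abA.
- by apply/sat_Imp => sa A _; apply.
- apply/sat_Imp => sna sa.
  exact: (sna _ (expertiseC (expertise_Snd M a))).
- apply/sat_Imp => sab; apply/sat_Imp => sa y.
  by apply: (sat_Imp y a b).1 (sab y) _; apply: sa.
- by apply/sat_Imp; apply.
- by apply/sat_Imp => na _.
- apply/sat_Iff; split=> [ea y|sa /=].
    by apply: (sat_Imp y (Snd a) a).2 => /(_ _ ea); apply.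
  have <- : [set y : M | sat y (Snd a)] = [set y : M | sat y a].
    apply/seteqP; split=> y; first exact: (sat_Imp y (Snd a) a).1 (sa y).
    by move=> ya A _; apply.
  exact: expertise_Snd.
- apply/sat_Imp => /= sa /(_ _ (expertise0 M)); apply=> y /=; exact.
- by apply: (sat_Imp x a b).1 (ihab M x) _; apply: iha.
- by move=> y; apply: iha.
- have ab : [set y : M | sat y a] = [set y : M | sat y b].
    by apply/seteqP; split=> y; have [] := (sat_Iff y a b).1 (ihab M y).
  by apply/sat_Iff; rewrite /= ab.
Qed.

End Soundness.

(** * Derivability from hypotheses and maximal consistent sets *)

Section Derivations.
Variable V : Type.
Implicit Types (a b c : formula V) (G D : set (formula V)).

(* Only modus ponens is applied to the hypotheses, so that the deduction theorem
   holds. *)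
Inductive derives G : formula V -> Prop :=
| derives_thm a : L_theorem a -> derives G a
| derives_hyp a : G a -> derives G a
| derives_mp a b : derives G (Imp a b) -> derives G a -> derives G b.

Lemma L_imp_trans a b c :
  L_theorem (Imp a b) -> L_theorem (Imp b c) -> L_theorem (Imp a c).
Proof.
move=> ab bc; apply: L_MP bc; apply: L_MP ab; tauto_check.
Qed.

Lemma derives_mono G D a : G `<=` D -> derives G a -> derives D a.
Proof.
move=> GD; elim=> [b /derives_thm//|b /GD /derives_hyp//|b c _ ibc _ ib].
exact: derives_mp ib.
Qed.

Lemma derives_cut G D a :
  (forall b, D b -> derives G b) -> derives D a -> derives G a.
Proof.
by move=> DG; elim=> [b /derives_thm|b /DG|b c _ ibc _ /(derives_mp ibc)].
Qed.

Lemma deduction G a b : derives (G `|` [set a]) b -> derives G (Imp a b).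
Proof.
elim=> [{}b thb|{}b [Gb|->]|{}b c _ ibc _ ib].
- apply: derives_thm; apply: L_MP thb; tauto_check.
- apply: derives_mp (derives_hyp Gb); apply: derives_thm; tauto_check.
- apply: derives_thm; tauto_check.
- apply: derives_mp ib; apply: derives_mp ibc; apply: derives_thm; tauto_check.
Qed.

(** A derivation uses finitely many hypotheses, so one member of the chain suffices; the left
    disjunct covers the empty chain. *)
Lemma derives_chain G (F : set (set (formula V))) a :
  total_on F subset -> derives (G `|` \bigcup_(D in F) D) a ->
  derives G a \/ exists2 D, F D & derives (G `|` D) a.
Proof.
move=> totF; elim=> [b thb|b [Gb|[D FD Db]]|b c _ ibc _ ib].
- by left; apply: derives_thm.
- by left; apply: derives_hyp.
- by right; exists D => //; apply: derives_hyp; right.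
have GU D d : derives G d -> derives (G `|` D) d.
  by apply: derives_mono; apply: subsetUl.
case: ibc ib => [bc|[D FD bc]] [ib|[D' FD' ib]].
- by left; apply: derives_mp ib.
- by right; exists D' => //; apply: derives_mp ib; apply: GU.
- by right; exists D => //; apply: derives_mp bc _; apply: GU.
- have [DD'|D'D] := totF _ _ FD FD'; right.
    exists D' => //; apply: derives_mp ib.
    by apply: derives_mono bc; apply: setUS.
  exists D => //; apply: derives_mp bc _.
  by apply: derives_mono ib; apply: setUS.
Qed.

Record maximal_consistent G : Prop := MaximalConsistent {
  mc_closed : forall a, derives G a -> G a;
  mc_Neg : forall a, G (Neg a) <-> ~ G a
}.

(** Zorn's lemma is applied to the sets that, added to [G], still do not derive [c]. Maximality
    decides every [a]: were both [a] and [Neg a] missing, each would imply [c], hence [c] would be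
    derivable. *)
Lemma lindenbaum G c : ~ derives G c ->
  exists D, [/\ maximal_consistent D, G `<=` D & ~ D c].
Proof.
move=> nGc.
have [|E [nEc maxE]] := @Zorn_bigcup _ [set D | ~ derives (G `|` D) c].
  by move=> F FP totF /= /(derives_chain totF)[//|[D /FP]].
set D := G `|` E in nEc.
have maxD a : ~ D a -> derives (D `|` [set a]) c.
  move=> nDa; apply: contrapT => nc; apply: (maxE (E `|` [set a])); last first.
    by rewrite /= setUA.
  split=> [|Ea]; first exact: subsetUl.
  by apply: nDa; right; apply: Ea; right.
exists D; split; [split=> a|exact: subsetUl|by move/derives_hyp].
- move=> da; apply: contrapT => /maxD dc; apply: nEc; apply: derives_cut dc.
  by move=> b [/derives_hyp//|->].
- split=> [Dna Da|/maxD/deduction ac].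
    apply: nEc; apply: derives_mp (derives_hyp Da).
    apply: derives_mp (derives_hyp Dna); apply: derives_thm; tauto_check.
  apply: contrapT => /maxD/deduction nac.
  apply: nEc; apply: derives_mp nac; apply: derives_mp ac.
  apply: derives_thm; tauto_check.
Qed.

Section MaximalConsistent.
Variable G : set (formula V).
Hypothesis mcG : maximal_consistent G.

Lemma mc_thm a : L_theorem a -> G a.
Proof. by move=> tha; apply: mc_closed => //; apply: derives_thm. Qed.

Lemma mc_mp a b : G (Imp a b) -> G a -> G b.
Proof.
move=> /derives_hyp Gab /derives_hyp Ga; apply: mc_closed => //.
exact: derives_mp Ga.
Qed.

Lemma mc_L a b : L_theorem (Imp a b) -> G a -> G b.
Proof. by move/mc_thm/mc_mp. Qed.

Lemma mc_And a b : G (And a b) <-> G a /\ G b.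
Proof.
split=> [Gab|[Ga Gb]]; first by split; apply: mc_L Gab; tauto_check.
by apply: mc_mp Gb; apply: mc_L Ga; tauto_check.
Qed.

Lemma mc_Imp a b : G (Imp a b) <-> (G a -> G b).
Proof.
split=> [/mc_mp//|ab]; have [/ab Gb|/(mc_Neg mcG) Gna] := pselect (G a).
  by apply: mc_L Gb; tauto_check.
by apply: mc_L Gna; tauto_check.
Qed.

Lemma mc_Iff a b : L_theorem (Iff a b) -> (G a <-> G b).
Proof. by move/mc_thm/mc_And=> [/mc_Imp ab /mc_Imp ba]. Qed.

End MaximalConsistent.

(** * Canonical accessibility for an arbitrary S5 box *)

Section S5.
Variable Box : formula V -> formula V.
Hypothesis nec : forall a, L_theorem a -> L_theorem (Box a).
Hypothesis axK : forall a b,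
  L_theorem (Imp (Box (Imp a b)) (Imp (Box a) (Box b))).
Hypothesis axT : forall a, L_theorem (Imp (Box a) a).
Hypothesis ax5 : forall a, L_theorem (Imp (Neg (Box a)) (Box (Neg (Box a)))).

Lemma box_mono a b : L_theorem (Imp a b) -> L_theorem (Imp (Box a) (Box b)).
Proof. by move/nec; apply: L_MP. Qed.

(** With dia dual to [Box]: T gives dia of [Box a], axiom 5 boxes it, and the contrapositive of 5
    turns dia of [Box a] back into [Box a] under the box. *)
Lemma box4 a : L_theorem (Imp (Box a) (Box (Box a))).
Proof.
have diabox : L_theorem (Imp (Neg (Box (Neg (Box a)))) (Box a)).
  by apply: L_MP (ax5 a); tauto_check.
apply: L_imp_trans (box_mono diabox); apply: L_imp_trans (ax5 (Neg (Box a))).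
by apply: L_MP (axT (Neg (Box a))); tauto_check.
Qed.

Lemma derives_box G a :
  derives [set b | derives G (Box b)] a -> derives G (Box a).
Proof.
elim=> [b /nec/derives_thm//|//|b c _ ibc _ ib].
by apply: derives_mp ib; apply: derives_mp ibc; apply: derives_thm.
Qed.

Definition box_equiv G D := forall a, G (Box a) <-> D (Box a).

(** [D] extends the formulas whose box is in [G]. Axiom 4 carries [Box b] from [G] to [D], and axiom
    5 carries [Neg (Box b)], hence the equivalence. *)
Lemma box_witness G a : maximal_consistent G -> ~ G (Box a) ->
  exists D, [/\ maximal_consistent D, box_equiv G D & ~ D a].
Proof.
move=> mcG nGa.
have [|D [mcD GD nDa]] := @lindenbaum [set b | derives G (Box b)] a.
  by move/derives_box/(mc_closed mcG).
have {}GD b : G (Box b) -> D b by move=> Gb; apply/GD/derives_hyp.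
exists D; split=> // b; split=> [Gb|Db]; first exact/GD/(mc_L mcG (box4 b)).
apply: contrapT => /(mc_Neg mcG)/(mc_L mcG (ax5 b))/GD.
by move/(mc_Neg mcD).
Qed.

End S5.

(** * S5 laws for the dual of [Snd] *)

Definition BoxS a := Neg (Snd (Neg a)).

Lemma L_Snd_NegNeg a : L_theorem (Iff (Snd (Neg (Neg a))) (Snd a)).
Proof. by apply: L_RS; tauto_check. Qed.

Lemma BoxS_nec a : L_theorem a -> L_theorem (BoxS a).
Proof. by move/L_NecA; apply: L_MP; apply: L_Inc. Qed.

Lemma BoxS_K a b : L_theorem (Imp (BoxS (Imp a b)) (Imp (BoxS a) (BoxS b))).
Proof.
have ab : L_theorem
    (Iff (Snd (And (Neg b) (Neg (Neg a)))) (Snd (Neg (Imp a b)))).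
  by apply: L_RS; tauto_check.
(* This instance of [L_KS] is K contraposed, up to the equivalence [ab]. *)
apply: L_MP ab; apply: L_MP (L_KS (Neg b) (Neg a)); tauto_check.
Qed.

Lemma BoxS_T a : L_theorem (Imp (BoxS a) a).
Proof. by apply: L_MP (L_TS (Neg a)); tauto_check. Qed.

Lemma BoxS_5 a : L_theorem (Imp (Neg (BoxS a)) (BoxS (Neg (BoxS a)))).
Proof.
apply: L_MP (L_5S (Neg a)); apply: L_MP (L_Snd_NegNeg (BoxS a)); tauto_check.
Qed.

(** Axiom 4 and Inc give [BoxS (All a)] from [All a]; it transfers to the other set, where T for
    [BoxS] returns [All a]. *)
Lemma box_equiv_SA G D : maximal_consistent G -> maximal_consistent D ->
  box_equiv BoxS G D -> box_equiv (@All V) G D.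
Proof.
have half G' D' : maximal_consistent G' -> maximal_consistent D' ->
    box_equiv BoxS G' D' -> forall a, G' (All a) -> D' (All a).
  move=> mcG mcD GD a.
  move/(mc_L mcG (box4 (@L_NecA V) (@L_KA V) (@L_TA V) (@L_5A V) a)).
  by move/(mc_L mcG (L_Inc _))/GD/(mc_L mcD (BoxS_T _)).
move=> mcG mcD GD a; split; first exact: half.
by apply: half => // b; split=> /GD.
Qed.

(** * The canonical model and completeness *)

Section CanonicalModel.
Variable root : set (formula V).

Definition world :=
  {G : set (formula V) | maximal_consistent G /\ box_equiv (@All V) root G}.
Implicit Types (w u : world).

Definition mem_world w a := sval w a.

Lemma world_mc w : maximal_consistent (mem_world w).
Proof. by case: w => G []. Qed.

Lemma world_All w a : mem_world w (All a) <-> forall u, mem_world u a.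
Proof.
split=> [wa u|ua].
  apply: (mc_L (world_mc u) (L_TA a)).
  by case: w u wa => [G [mG rG]] [D [mD rD]]; rewrite /mem_world /= -rG rD.
apply: contrapT => nwa.
have [D [mD wD nDa]] :=
  box_witness (@L_NecA V) (@L_KA V) (@L_TA V) (@L_5A V) (world_mc w) nwa.
have rD : box_equiv (@All V) root D.
  by move=> b; rewrite -wD; apply: (svalP w).2.
exact/nDa/(ua (exist _ D (conj mD rD))).
Qed.

Definition S_equiv w u := box_equiv BoxS (mem_world w) (mem_world u).

Lemma world_Snd w a :
  mem_world w (Snd a) <-> exists2 u, S_equiv w u & mem_world u a.
Proof.
have SnegBox u : mem_world u (Snd a) <-> ~ mem_world u (BoxS (Neg a)).
  have mcu := world_mc u.
  by rewrite -(mc_Iff mcu (L_Snd_NegNeg a)) -(mc_Neg mcu); split;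
    apply: mc_L => //; tauto_check.
split=> [/SnegBox nwa|[u wu ua]]; last first.
  apply/SnegBox => /wu; apply/SnegBox.
  exact: (mc_L (world_mc u) (L_TS a) ua).
have [D [mD wD nDa]] :=
  box_witness BoxS_nec BoxS_K BoxS_T BoxS_5 (world_mc w) nwa.
(* [BoxS]-equivalence refines [All]-equivalence, so the witness stays among the worlds over
   [root]. *)
have rD : box_equiv (@All V) root D.
  move=> b; rewrite -(box_equiv_SA (world_mc w) mD wD).
  exact: (svalP w).2.
exists (exist _ D (conj mD rD)) => //.
by apply: contrapT => /(mc_Neg mD).
Qed.

Definition saturated : set (set world) :=
  [set A | forall w u, S_equiv w u -> A w -> A u].

Lemma saturatedT : saturated setT.
Proof. by []. Qed.

Lemma saturatedC A : saturated A -> saturated (~` A).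
Proof.
by move=> satA w u wu nAw Au; apply: nAw; apply: satA Au => b; split=> /wu.
Qed.

Lemma saturated_bigcap (F : set (set world)) :
  F `<=` saturated -> saturated (\bigcap_(A in F) A).
Proof. by move=> Fsat w u wu Fw A FA; apply: (Fsat _ FA) wu _; apply: Fw. Qed.

Definition canonical_model : expertise_model V :=
  @ExpertiseModel V (ExpertiseFrame saturatedT saturatedC saturated_bigcap)
    (fun p => [set w | mem_world w (Var p)]).

Lemma truth_lemma a (w : canonical_model) : sat w a <-> mem_world w a.
Proof.
elim: a w => [p|a iha|a iha b ihb|a iha|a iha|a iha] w //=.
- by rewrite iha (mc_Neg (world_mc w)).
- by rewrite iha ihb (mc_And (world_mc w)).
- have -> : [set y : canonical_model | sat y a] = [set u | mem_world u a].
    by apply/seteqP; split=> u /iha.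
  rewrite (mc_Iff (world_mc w) (L_ES a)) world_All.
  split=> [sata u|sata u v uv /= ua].
    apply/(mc_Imp (world_mc u)) => /world_Snd[v uv va].
    by apply: sata va => b; split=> /uv.
  have /(mc_Imp (world_mc v)) := sata v; apply; apply/world_Snd.
  by exists u => // b; split=> /uv.
- rewrite world_Snd; split=> [sa|[u wu ua] A satA aA].
    (* The test set is the saturation of the extension of [a], the least saturated set including
       it. *)
    apply: (sa [set v | exists2 u, S_equiv v u & mem_world u a]).
      move=> v v' vv' [u vu ua]; exists u => // b.
      by rewrite -vv'.
    by move=> v /iha va; exists v.
  by apply: (satA u w); [move=> b; split=> /wu|apply/aA/iha].
- by rewrite world_All; split=> sa u; apply/iha.
Qed.

End CanonicalModel.

Theorem completeness (phi : formula V) : valid phi -> L_theorem phi.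
Proof.
move=> vphi; apply: contrapT => nphi.
have [|G [mcG _ nGphi]] := @lindenbaum set0 phi.
  move=> d0; apply: nphi; by elim: d0 => [//|a []|a b _ thab _]; apply: L_MP.
apply: nGphi.
(* Taking [G] as the root makes it a world of its own canonical model. *)
pose w : world G := exist _ G (conj mcG (fun _ => iff_refl _)).
exact: (truth_lemma phi (w : canonical_model G)).1 (vphi _ _).
Qed.

End Derivations.

Theorem theorem2 (V : countType) (phi : formula V) :
  L_theorem phi <-> valid phi.
Proof. by split; [apply: soundness|apply: completeness]. Qed.
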